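(* Let $k>0$ be an integer. For all $\alpha\in\mathbb{C}^\times$ with $|\alpha|$ sufficiently small, $$\widehat{I}_k(\alpha)=\pi_k(\alpha),$$ where (A) $\widehat{I}_k$ is the hypergeometric function $$\widehat{I}_k(\alpha)=\sum_{j=0}^\infty \frac{\bigl((8k+4)j\bigr)!\,j!}{(2j)!\,\bigl((2k+1)j\bigr)!^2\,\bigl((4k+1)j\bigr)!}\,\alpha^j ;$$ (B) $\pi_k$ is the period $$\pi_k(\alpha)=\frac{1}{2\pi i}\oint_{\gamma_{k,\alpha}}\frac{t^{2k}\,dt}{y}$$ of the family of hyperelliptic curves $Y_{k,\alpha}$, where $t=t_1/t_0$ and $Y_{k,\alpha}$, $\gamma_{k,\alpha}\subset Y_{k,\alpha}$ are the curve and the cycle described in the context.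
   Context: Fix an integer $k>0$. For $\alpha\in\mathbb{C}^\times$ let $Y_{k,\alpha}\subset\mathbb{P}(1,1,3k+2)$ (weighted homogeneous coordinates $t_0,t_1,y$) be the curve $\alpha y^2=h_{k,\alpha}(t_0,t_1)$, where $$h_{k,\alpha}(t_0,t_1)=t_1\bigl(4t_1^{2k+1}+\alpha t_0^{2k+1}\bigr)\bigl(-64t_1^{4k+2}+t_0t_1^{4k+1}-32\alpha t_0^{2k+1}t_1^{2k+1}-4\alpha^2t_0^{4k+2}\bigr).$$ For $\alpha\ne\alpha_{k,0}:=\frac{(4k+1)^{4k+1}}{4^{8k+3}(2k+1)^{2(2k+1)}}$ it is a nonsingular hyperelliptic curve of genus $3k+1$. Work in the affine chart $t_0=1$ with $t=t_1$, and let $p_{k,\alpha}\colon Y_{k,\alpha}\to\mathbb{P}^1$, $(t,y)\mapsto t$, be the $2:1$ cover. The cycle $\gamma_{k,\alpha}$: choose a continuous function $\rho_k\colon(0,1)\to\mathbb{R}$ such that $r^{2/(4k+1)}\ll\rho_k(r)\ll r^{1/(2k+1)}$ for $r\ll1$ (i.e. $r^{2/(4k+1)}/\rho_k(r)\to0$ and $\rho_k(r)/r^{1/(2k+1)}\to0$ as $r\to0^+$). For $0<|\alpha|\ll1$ let $\overline{\gamma}_{k,\alpha}$ be the (counterclockwise) circle of radius $\rho_k(|\alpha|)$ around $0\in\mathbb{C}$. It contains no branch point of $p_{k,\alpha}$ and separates the branch points into two sets of even cardinality, so $p_{k,\alpha}^{-1}(\overline{\gamma}_{k,\alpha})$ is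 a union of two disjoint circles. The cycle $\gamma_{k,\alpha}$ is the one of these two lifts on which $$y=t^{2k+1}\Bigl(1+\tfrac{4t^{2k+1}}{\alpha}\Bigr)^{1/2}\Bigl(1-t\bigl(8+\tfrac{2\alpha}{t^{2k+1}}\bigr)^2\Bigr)^{1/2},$$ where both square roots are given by their (convergent) binomial expansions with constant term $1$, i.e. $(1+u)^{1/2}=\sum_{n\ge 0}\binom{1/2}{n}u^n$. *)

(* Defs.v *)
(* Stdlib reals with Coquelicot; C is Coquelicot's field of complex numbers. *)
From Stdlib Require Import Reals Factorial Lia.
From Coquelicot Require Import Coquelicot.

Open Scope C_scope.

Definition h (k : nat) (alpha t0 t1 : C) : C :=
  t1
  * (RtoC 4 * t1 ^ (2 * k + 1) + alpha * t0 ^ (2 * k + 1))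
  * (- (RtoC 64 * t1 ^ (4 * k + 2)) + t0 * t1 ^ (4 * k + 1)
     - RtoC 32 * alpha * t0 ^ (2 * k + 1) * t1 ^ (2 * k + 1)
     - RtoC 4 * alpha ^ 2 * t0 ^ (4 * k + 2)).

(* The curve in P(1,1,3k+2), as a condition on weighted homogeneous
   coordinates (t0, t1, y); it only depends on the point of P(1,1,3k+2) they
   represent, see [curve_scale]. *)
Definition curve (k : nat) (alpha t0 t1 y : C) : Prop :=
  ~ (t0 = RtoC 0 /\ t1 = RtoC 0 /\ y = RtoC 0) /\
  alpha * y ^ 2 = h k alpha t0 t1.

Lemma curve_scale (k : nat) (alpha t0 t1 y l : C) :
  l <> RtoC 0 -> curve k alpha t0 t1 y ->
  curve k alpha (l * t0) (l * t1) (l ^ (3 * k + 2) * y).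
Proof.
intros hl [hnz he]; split.
- intros [e0 [e1 e2]]; apply hnz.
  assert (hc : forall u v : C, u <> RtoC 0 -> u * v = RtoC 0 -> v = RtoC 0).
  { intros u v hu huv.
    replace v with (/ u * (u * v)) by (field; exact hu).
    rewrite huv; apply Cmult_0_r. }
  repeat split; [apply (hc l) | apply (hc l) | apply (hc (l ^ (3 * k + 2)))];
    auto using Cpow_nz.
- transitivity (l ^ (6 * k + 4) * (alpha * y ^ 2)).
  + replace (6 * k + 4)%nat with ((3 * k + 2) + (3 * k + 2))%nat by lia.
    rewrite (Cpow_add_r l (3 * k + 2)).
    set (m := l ^ (3 * k + 2)); ring.
  + rewrite he; unfold h; rewrite !Cpow_mult_l.
    assert (e1 : l ^ (2 * k + 1) = l ^ (2 * k) * l)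
      by (rewrite Cpow_add_r, Cpow_1_r; reflexivity).
    assert (e2 : l ^ (4 * k + 1) = l ^ (2 * k) * l ^ (2 * k) * l).
    { rewrite <- !Cpow_add_r, Cmult_comm, <- Cpow_S; f_equal; lia. }
    assert (e3 : l ^ (4 * k + 2) = l ^ (4 * k + 1) * l).
    { rewrite Cmult_comm, <- Cpow_S; f_equal; lia. }
    assert (e4 : l ^ (6 * k + 4) = l ^ (4 * k + 2) * l ^ (2 * k + 1) * l).
    { rewrite <- !Cpow_add_r, Cmult_comm, <- Cpow_S; f_equal; lia. }
    rewrite e4, e3, e2, e1.
    generalize (l ^ (2 * k)) (t0 ^ (2 * k + 1)) (t1 ^ (2 * k + 1))
      (t0 ^ (4 * k + 2)) (t1 ^ (4 * k + 2)) (t1 ^ (4 * k + 1)); intros; ring.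
Qed.

(* A pair (t, y) is the point [1 : t : y] of the chart t0 = 1. *)
Definition chart_curve (k : nat) (alpha : C) (q : C * C) : Prop :=
  curve k alpha (RtoC 1) (fst q) (snd q).

Definition cover (q : C * C) : C := fst q.

(* Only the germ of rho at 0+ matters, so positivity (rho is a radius) is only
   required there. *)
Definition admissible_radius (k : nat) (rho : R -> R) : Prop :=
  ((forall r : R, 0 < r < 1 -> continuous rho r) /\
   at_right 0 (fun r => 0 < rho r) /\
   filterlim (fun r => Rpower r (2 / INR (4 * k + 1)) / rho r)
     (at_right 0) (locally 0) /\
   filterlim (fun r => rho r / Rpower r (1 / INR (2 * k + 1)))
     (at_right 0) (locally 0))%R.

Definition circle (radius theta : R) : C :=
  ((radius * cos theta)%R, (radius * sin theta)%R).

(* A closed path is a continuous map on R / 2 pi Z, encoded as a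
   2 pi - periodic function on R. *)
Definition closed_path (g : R -> C * C) : Prop :=
  (forall theta : R, continuous g theta) /\
  (forall theta : R, g (theta + 2 * PI)%R = g theta).

Definition circle_lift (k : nat) (alpha : C) (radius : R) (g : R -> C * C)
  : Prop :=
  closed_path g /\
  (forall theta : R, chart_curve k alpha (g theta)) /\
  (forall theta : R, cover (g theta) = circle radius theta).

Fixpoint gbinom (x : R) (n : nat) : R :=
  match n with
  | O => 1%R
  | S m => (gbinom x m * (x - INR m) / INR (S m))%R
  end.

(* The binomial expansion of (1 + u) ^ (1/2) converges to s. *)
Definition is_sqrt1p (u s : C) : Prop :=
  is_series (V := C_NormedModule)
    (fun n : nat => RtoC (gbinom (1 / 2) n) * u ^ n) s.

Definition on_branch (k : nat) (alpha : C) (q : C * C) : Prop :=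
  let t := fst q in
  exists s1 s2 : C,
    is_sqrt1p (RtoC 4 * t ^ (2 * k + 1) / alpha) s1 /\
    is_sqrt1p (- (t * (RtoC 8 + RtoC 2 * alpha / t ^ (2 * k + 1)) ^ 2)) s2 /\
    snd q = t ^ (2 * k + 1) * s1 * s2.

Definition is_gamma (k : nat) (rho : R -> R) (alpha : C) (g : R -> C * C)
  : Prop :=
  circle_lift k alpha (rho (Cmod alpha)) g /\
  (forall theta : R, on_branch k alpha (g theta)).

(* The integral of the form f(t, y) dt along g restricted to [a, b] is I. *)
Definition is_path_integral (f : C * C -> C) (g : R -> C * C) (a b : R) (I : C)
  : Prop :=
  exists dt : R -> C,
    (forall theta : R, (a < theta < b)%R ->
       is_derive (V := C_R_NormedModule) (fun s => cover (g s)) theta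
         (dt theta)) /\
    is_RInt (V := C_R_NormedModule)
      (fun theta => f (g theta) * dt theta) a b I.

(* v = 1/(2 pi i) * (integral of t^(2k) dt / y over the closed path g) *)
Definition is_period (k : nat) (g : R -> C * C) (v : C) : Prop :=
  exists I : C,
    is_path_integral (fun q => fst q ^ (2 * k) / snd q) g 0 (2 * PI) I /\
    v = / (RtoC 2 * RtoC PI * Ci) * I.

Definition Ihat_coef (k j : nat) : R :=
  (INR (fact ((8 * k + 4) * j)) * INR (fact j) /
   (INR (fact (2 * j)) * INR (fact ((2 * k + 1) * j)) ^ 2
    * INR (fact ((4 * k + 1) * j))))%R.

Definition is_Ihat (k : nat) (alpha v : C) : Prop :=
  is_series (V := C_NormedModule)
    (fun j : nat => RtoC (Ihat_coef k j) * alpha ^ j) v.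

(* Main.v *)
(* Put N = 2k+1.  On the lift, t^(2k) dt / y = (dt / t) (1 + u)^(-1/2) (1 + w)^(-1/2)
   with u = 4 t^N / alpha and w = - t (8 + 2 alpha / t^N)^2, both bounded by 1/2
   in modulus once alpha is small, because of the growth conditions on rho.
   Expanding binomially and integrating over the circle keeps only the constant
   term in t.  The monomial of u^m w^n containing 8^l contributes iff
   N m + n = N (2n - l), i.e. n = N j and l + m = p := (4k+1) j, and then its
   power of alpha is j.  So the coefficient of alpha^j is a convolution of
   binom(-1/2, m) with binom(2n, p - m), which Chu-Vandermonde turns into
   binom(2n - 1/2, p); this is the hypergeometric coefficient.  Taking
   2NJ terms in u and NJ terms in w gives exactly the J-th partial sum of
   the hypergeometric series, so its convergence comes with the uniform
   convergence of the integrand. *)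
Require Import Defs.
From Stdlib Require Import Reals Lra Lia Factorial.
From Coquelicot Require Import Coquelicot.

Open Scope C_scope.

(* Equalities between finite sums are typed in an algebraic structure projecting
   to C, which [ring] does not recognise. *)
Ltac ring_C := match goal with |- ?l = ?r => change (@eq C l r) end; ring.

(** * Generalised binomial coefficients *)

Lemma Cmult_eq_reg_l (a x y : C) : a * x = a * y -> a <> 0 -> x = y.
Proof.
intros h ha; transitivity (/ a * (a * x)); [now field | ].
rewrite h; now field.
Qed.

(** A summand with a factor [i] vanishes at [i = 0]; a recurrence then rewrites it as a summand
    whose index is one lower. *)
Lemma sum_n_rec_shift (a b : nat -> C) (n : nat) :
  b O = 0 -> (forall i, (i <= n)%nat -> b (S i) = a i) ->
  sum_n b (S n) = sum_n a n.
Proof.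
intros h0 hS; induction n as [|n IH].
- rewrite sum_Sn, !sum_O, h0, hS by lia; apply Cplus_0_l.
- rewrite sum_Sn, IH, (sum_Sn a), hS by (intros; try apply hS; lia); reflexivity.
Qed.

Lemma RtoC_INR_S_neq0 (n : nat) : RtoC (INR (S n)) <> 0.
Proof. intros e; apply RtoC_inj in e; now apply (not_0_INR (S n)). Qed.

Lemma RtoC_INR_fact_neq0 (n : nat) : RtoC (INR (fact n)) <> 0.
Proof. intros e; apply RtoC_inj in e; exact (INR_fact_neq_0 n e). Qed.

(* With e = 1 the hypotheses describe generalised binomial coefficients, with
   e = 0 divided powers. *)
Lemma convolution_rec (e x y : C) (f g : nat -> C) (n : nat) :
  (forall i, RtoC (INR (S i)) * f (S i) = (x - e * RtoC (INR i)) * f i) ->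
  (forall i, RtoC (INR (S i)) * g (S i) = (y - e * RtoC (INR i)) * g i) ->
  RtoC (INR (S n)) * sum_n (fun i => f i * g (S n - i)%nat) (S n) =
  (x + y - e * RtoC (INR n)) * sum_n (fun i => f i * g (n - i)%nat) n.
Proof.
intros hf hg.
rewrite <- (sum_n_mult_l (RtoC (INR (S n))) (fun i => f i * g (S n - i)%nat)).
rewrite <- (sum_n_mult_l (x + y - e * RtoC (INR n)) (fun i => f i * g (n - i)%nat)).
(* Leibniz rule: the factor [S n] is split as [i + (S n - i)], one part for the recurrence of [f],
   the other for that of [g]. *)
transitivity (sum_n (fun i => plus
   (RtoC (INR i) * f i * g (S n - i)%nat)
   (f i * (RtoC (INR (S n - i)) * g (S n - i)%nat))) (S n)).
{ apply sum_n_ext_loc; intros i hi; rewrite minus_INR, RtoC_minus by lia.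
  unfold mult, plus; simpl; ring. }
rewrite sum_n_plus.
rewrite (sum_n_rec_shift (fun i => (x - e * RtoC (INR i)) * f i * g (n - i)%nat)).
2: { simpl; ring. }
2: { intros i hi; rewrite <- hf; reflexivity. }
rewrite (sum_Sn _ n), Nat.sub_diag.
rewrite (sum_n_ext_loc
  (fun i => f i * (RtoC (INR (S n - i)) * g (S n - i)%nat))
  (fun i => f i * ((y - e * RtoC (INR (n - i))) * g (n - i)%nat)) n).
2: { intros i hi; rewrite Nat.sub_succ_l by lia; now rewrite hg. }
rewrite plus_assoc, <- sum_n_plus.
(* The term [i = S n] of the second sum carries the factor [INR 0], so both sums now run up to
   [n]. *)
replace (f (S n) * _) with (zero (G := C_AbelianMonoid)) by (simpl; unfold zero; simpl; ring).
rewrite plus_zero_r.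
apply sum_n_ext_loc; intros i hi; rewrite minus_INR, RtoC_minus by lia.
unfold mult, plus; simpl; ring.
Qed.

Lemma gbinom_rec (x : R) (n : nat) :
  RtoC (INR (S n)) * RtoC (gbinom x (S n)) =
  (RtoC x - 1 * RtoC (INR n)) * RtoC (gbinom x n).
Proof.
change (gbinom x (S n)) with (gbinom x n * (x - INR n) / INR (S n))%R.
rewrite Cmult_1_l, <- RtoC_minus, <- !RtoC_mult; f_equal; field.
now apply not_0_INR.
Qed.

(** By [convolution_rec] with [e = 1], the convolution obeys the first-order recurrence of
    [gbinom (x + y)], and both start at 1. *)
Lemma gbinom_vandermonde (x y : R) (n : nat) :
  sum_n (fun i => RtoC (gbinom x i) * RtoC (gbinom y (n - i))) n =
  RtoC (gbinom (x + y) n).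
Proof.
induction n as [|n IH].
- rewrite sum_O; simpl; ring.
- assert (h := convolution_rec 1 x y (fun i => RtoC (gbinom x i))
    (fun i => RtoC (gbinom y i)) n (gbinom_rec x) (gbinom_rec y)).
  cbv beta in h; rewrite IH, <- RtoC_plus, <- gbinom_rec in h.
  exact (Cmult_eq_reg_l _ _ _ h (RtoC_INR_S_neq0 n)).
Qed.

Lemma divided_pow_rec (x : C) (n : nat) :
  RtoC (INR (S n)) * (x ^ S n / RtoC (INR (fact (S n)))) =
  (x - 0 * RtoC (INR n)) * (x ^ n / RtoC (INR (fact n))).
Proof.
rewrite fact_simpl, mult_INR, RtoC_mult, Cpow_S.
field; split; [apply RtoC_INR_fact_neq0 | apply RtoC_INR_S_neq0].
Qed.

Lemma gbinom_nat (n i : nat) : (i <= n)%nat ->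
  gbinom (INR n) i = (INR (fact n) / (INR (fact i) * INR (fact (n - i))))%R.
Proof.
induction i as [|i IH]; intros hi.
- rewrite Nat.sub_0_r; simpl; field; apply INR_fact_neq_0.
- change (gbinom (INR n) (S i)) with (gbinom (INR n) i * (INR n - INR i) / INR (S i))%R.
  rewrite IH by lia.
  replace (n - i)%nat with (S (n - S i)) by lia.
  rewrite !fact_simpl, !mult_INR.
  replace (INR n - INR i)%R with (INR (S (n - S i))).
  2: { rewrite <- minus_INR by lia; f_equal; lia. }
  field; repeat split; try apply INR_fact_neq_0; now apply not_0_INR.
Qed.

(** Divided by [n!], the expansion is a convolution of divided powers, the case [e = 0] of
    [convolution_rec]. The coefficients are kept as [gbinom] so that [gbinom_vandermonde] can absorb
    them later. *)
Lemma Cpow_binomial (x y : C) (n : nat) :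
  (x + y) ^ n =
  sum_n (fun i => RtoC (gbinom (INR n) i) * x ^ i * y ^ (n - i)) n.
Proof.
assert (hf := RtoC_INR_fact_neq0).
assert (h : sum_n (fun i => x ^ i / RtoC (INR (fact i)) *
    (y ^ (n - i) / RtoC (INR (fact (n - i))))) n = (x + y) ^ n / RtoC (INR (fact n))).
{ induction n as [|n IH].
  - rewrite sum_O; simpl; field; intros e; apply RtoC_inj in e; lra.
  - assert (h := convolution_rec 0 x y (fun i => x ^ i / RtoC (INR (fact i)))
      (fun i => y ^ i / RtoC (INR (fact i))) n (divided_pow_rec x) (divided_pow_rec y)).
    cbv beta in h; rewrite IH, <- divided_pow_rec in h.
    exact (Cmult_eq_reg_l _ _ _ h (RtoC_INR_S_neq0 n)). }
transitivity (RtoC (INR (fact n)) * ((x + y) ^ n / RtoC (INR (fact n)))).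
{ field; apply hf. }
rewrite <- h.
rewrite <- (sum_n_mult_l (RtoC (INR (fact n)))).
apply sum_n_ext_loc; intros i hi; rewrite gbinom_nat, RtoC_div, RtoC_mult by
  (try apply Rmult_integral_contrapositive_currified; auto using INR_fact_neq_0).
unfold mult; simpl; field; split; apply hf.
Qed.

(** Raises both arguments at once, as the induction on [p] in [gbinom_half_shift] requires. *)
Lemma gbinom_absorption (x : R) (n : nat) :
  gbinom (x + 1) (S n) = (gbinom x n * (x + 1) / INR (S n))%R.
Proof.
induction n as [|n IH].
- simpl; field.
- change (gbinom (x + 1) (S (S n)))
    with (gbinom (x + 1) (S n) * (x + 1 - INR (S n)) / INR (S (S n)))%R.
  rewrite IH; change (gbinom x (S n)) with (gbinom x n * (x - INR n) / INR (S n))%R.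
  rewrite (S_INR (S n)), S_INR; field.
  assert (h := pos_INR n); lra.
Qed.

Lemma gbinom_neg_half (n : nat) :
  gbinom (- (1 / 2)) n =
  ((- 1) ^ n * INR (fact (2 * n)) / (4 ^ n * INR (fact n) ^ 2))%R.
Proof.
induction n as [|n IH]; [simpl; field | ].
change (gbinom (- (1 / 2)) (S n))
  with (gbinom (- (1 / 2)) n * (- (1 / 2) - INR n) / INR (S n))%R.
rewrite IH; replace (2 * S n)%nat with (S (S (2 * n))) by lia.
rewrite !fact_simpl, !mult_INR, <- !tech_pow_Rmult, !S_INR, mult_INR; simpl (INR 2).
assert (h := pos_INR n); field; repeat split;
  try apply INR_fact_neq_0; try apply pow_nonzero; lra.
Qed.

(** The numerator is the product of the half-integers from [j + 1/2] to [p + j - 1/2], a quotient of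
    products of odd numbers and hence of factorials. *)
Lemma gbinom_half_shift (j p : nat) :
  gbinom (INR (p + j) - 1 / 2) p =
  (INR (fact (2 * (p + j))) * INR (fact j) /
   (4 ^ p * INR (fact (p + j)) * INR (fact (2 * j)) * INR (fact p)))%R.
Proof.
induction p as [|p IH].
- simpl; field; split; apply INR_fact_neq_0.
- replace (S p + j)%nat with (S (p + j)) by lia; rewrite S_INR.
  replace (INR (p + j) + 1 - 1 / 2)%R with (INR (p + j) - 1 / 2 + 1)%R by ring.
  rewrite gbinom_absorption, IH.
  replace (2 * S (p + j))%nat with (S (S (2 * (p + j)))) by lia.
  rewrite (fact_simpl p), (fact_simpl (p + j)), (fact_simpl (S (2 * (p + j)))),
    (fact_simpl (2 * (p + j))), !mult_INR, <- !tech_pow_Rmult, !S_INR, mult_INR;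
    simpl (INR 2).
  assert (h := pos_INR (p + j)); assert (h' := pos_INR p); field.
  repeat split; try apply INR_fact_neq_0; try apply pow_nonzero; lra.
Qed.

(** This is the shape in which the constant term delivers the coefficient. Since [2 n = p + j], the
    powers of two match, and the two signs [(-1) ^ n] cancel. *)
Lemma Ihat_coef_gbinom (k j : nat) :
  let n := ((2 * k + 1) * j)%nat in
  let p := ((4 * k + 1) * j)%nat in
  Ihat_coef k j =
  ((- 1) ^ n * gbinom (- (1 / 2)) n * 8 ^ p * 2 ^ j
   * gbinom (INR (2 * n) - 1 / 2) p)%R.
Proof.
intros n p.
assert (hn : (2 * n = p + j)%nat) by (unfold n, p; lia).
rewrite hn, gbinom_half_shift, gbinom_neg_half, <- hn.
unfold Ihat_coef; fold n p.
replace ((8 * k + 4) * j)%nat with (2 * (2 * n))%nat by (unfold n; lia).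
assert (h8 : (8 ^ p * 2 ^ j = 4 ^ n * 4 ^ p)%R).
{ replace 8%R with (2 * 4)%R by ring; rewrite Rpow_mult_distr.
  replace (4 ^ n)%R with (2 ^ p * 2 ^ j)%R; [ring | ].
  rewrite <- pow_add, <- hn, pow_mult; f_equal; ring. }
assert (h1 : ((- 1) ^ n * (- 1) ^ n = 1)%R).
{ rewrite <- Rpow_mult_distr; replace (- 1 * - 1)%R with 1%R by ring; apply pow1. }
assert (h4 : forall m, (4 ^ m)%R <> 0%R) by (intros; apply pow_nonzero; lra).
transitivity ((((- 1) ^ n * (- 1) ^ n) * (8 ^ p * 2 ^ j) *
  (INR (fact (2 * (2 * n))) * INR (fact j)) /
  (4 ^ n * 4 ^ p * INR (fact n) ^ 2 * INR (fact (2 * j)) * INR (fact p)))%R).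
- rewrite h1, h8; field; repeat split; auto using INR_fact_neq_0.
- field; repeat split; auto using INR_fact_neq_0.
Qed.

(** Each new factor [(x - n) / (n + 1)] has modulus at most 1. Binomial series are thereby dominated
    by geometric ones. *)
Lemma Rabs_gbinom_le1 (x : R) (n : nat) : (-1 <= x <= 1)%R -> (Rabs (gbinom x n) <= 1)%R.
Proof.
intros hx; induction n as [|n IH]; [simpl; rewrite Rabs_R1; lra | ].
change (gbinom x (S n)) with (gbinom x n * (x - INR n) / INR (S n))%R.
assert (h := pos_INR n); rewrite S_INR.
unfold Rdiv; rewrite Rmult_assoc, Rabs_mult.
apply (Rle_trans _ (1 * 1)); [ | lra].
apply Rmult_le_compat; try apply Rabs_pos; [exact IH | ].
rewrite Rabs_mult, Rabs_inv, (Rabs_pos_eq (INR n + 1)) by lra.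
apply (Rmult_le_reg_r (INR n + 1)); [lra | ].
rewrite Rmult_assoc, Rinv_l, Rmult_1_r, Rmult_1_l by lra.
apply Rabs_le; lra.
Qed.

(** * Complex series *)

Lemma pow_le_pow_exp (q : R) (m n : nat) :
  (0 <= q <= 1)%R -> (m <= n)%nat -> (q ^ n <= q ^ m)%R.
Proof.
intros hq hmn; replace n with (m + (n - m))%nat by lia; rewrite pow_add.
rewrite <- (Rmult_1_r (q ^ m)) at 2; apply Rmult_le_compat_l; [apply pow_le; lra | ].
rewrite <- (pow1 (n - m)); apply pow_incr; lra.
Qed.

Lemma sum_n_C (a : nat -> C) (n : nat) :
  sum_n a n = (sum_n (fun i => Re (a i)) n, sum_n (fun i => Im (a i)) n).
Proof.
induction n as [|n IH].
- rewrite !sum_O; apply surjective_pairing.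
- rewrite !sum_Sn, IH; reflexivity.
Qed.

Lemma is_series_C (a : nat -> C) (s : C) :
  is_series (V := C_NormedModule) a s <->
  is_series (fun i => Re (a i)) (Re s) /\ is_series (fun i => Im (a i)) (Im s).
Proof.
unfold is_series; split.
- intros h; split; apply filterlim_locally; intros eps;
    generalize (proj1 (filterlim_locally (U := C_UniformSpace) _ _) h eps);
    apply filter_imp; intros n hn; rewrite sum_n_C in hn; apply hn.
- intros [h1 h2]; apply (filterlim_locally (U := C_UniformSpace)); intros eps.
  generalize (filter_and _ _ (proj1 (filterlim_locally _ _) h1 eps)
    (proj1 (filterlim_locally _ _) h2 eps)).
  apply filter_imp; intros n hn; rewrite sum_n_C; exact hn.
Qed.

Lemma is_series_C_unique (a : nat -> C) (s s' : C) :
  is_series (V := C_NormedModule) a s -> is_series (V := C_NormedModule) a s' ->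
  s = s'.
Proof.
intros h h'; exact (filterlim_locally_unique (V := C_NormedModule) _ _ _ h h').
Qed.

Lemma ex_series_Rabs_le_geom (a : nat -> R) (q : R) :
  (0 <= q < 1)%R -> (forall n, Rabs (a n) <= q ^ n)%R ->
  ex_series (fun n => Rabs (a n)).
Proof.
intros hq ha; apply (ex_series_le (V := R_CompleteNormedModule) _ (fun n => q ^ n)%R).
- intros n; unfold norm; simpl; unfold abs; simpl; rewrite Rabs_Rabsolu; apply ha.
- apply ex_series_geom; rewrite Rabs_pos_eq; lra.
Qed.

Lemma Im_le_Cmod (z : C) : (Rabs (Im z) <= Cmod z)%R.
Proof. eapply Rle_trans; [apply Rmax_r | apply Rmax_Cmod]. Qed.

(** The bound [q ^ n] makes the four real series absolutely convergent. The real part of the product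
    is a difference of two real Cauchy products, the imaginary part a sum of two. *)
Lemma is_series_C_mult (a b : nat -> C) (sa sb : C) (q : R) :
  (0 <= q < 1)%R ->
  (forall n, Cmod (a n) <= q ^ n)%R -> (forall n, Cmod (b n) <= q ^ n)%R ->
  is_series (V := C_NormedModule) a sa -> is_series (V := C_NormedModule) b sb ->
  is_series (V := C_NormedModule)
    (fun n => sum_n (fun i => a i * b (n - i)%nat) n) (sa * sb).
Proof.
intros hq ha hb hsa hsb.
apply is_series_C in hsa; apply is_series_C in hsb.
destruct hsa as [ar ai]; destruct hsb as [br bi].
assert (habs : forall c : nat -> C, (forall n, Cmod (c n) <= q ^ n)%R ->
  ex_series (fun n => Rabs (Re (c n))) /\ ex_series (fun n => Rabs (Im (c n)))).
{ intros c hc; split; apply (ex_series_Rabs_le_geom _ q hq); intros n;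
    (eapply Rle_trans; [ | apply hc]); [apply re_le_Cmod | apply Im_le_Cmod]. }
destruct (habs a ha) as [aar aai]; destruct (habs b hb) as [abr abi].
apply is_series_C; split.
- apply (is_series_ext (fun n => minus
    (sum_f_R0 (fun i => Re (a i) * Re (b (n - i)%nat))%R n)
    (sum_f_R0 (fun i => Im (a i) * Im (b (n - i)%nat))%R n))).
  { intros n; rewrite sum_n_C; simpl.
    rewrite sum_n_Reals; symmetry; apply minus_sum. }
  apply (is_series_minus (V := R_NormedModule)); 
  [exact (is_series_mult _ _ _ _ ar br aar abr) | exact (is_series_mult _ _ _ _ ai bi aai abi)].
- apply (is_series_ext (fun n => plus
    (sum_f_R0 (fun i => Re (a i) * Im (b (n - i)%nat))%R n)
    (sum_f_R0 (fun i => Im (a i) * Re (b (n - i)%nat))%R n))).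
  { intros n; rewrite sum_n_C; simpl.
    now rewrite <- !sum_n_Reals, <- sum_n_plus. }
  apply (is_series_plus (V := R_NormedModule)); 
  [exact (is_series_mult _ _ _ _ ar bi aar abi) | exact (is_series_mult _ _ _ _ ai br aai abr)].
Qed.

Lemma Cmod_gbinom_term_le (x : R) (u : C) (q : R) (n : nat) :
  (-1 <= x <= 1)%R -> (Cmod u <= q)%R ->
  (Cmod (RtoC (gbinom x n) * u ^ n) <= q ^ n)%R.
Proof.
intros hx hu; rewrite Cmod_mult, Cmod_R, Cmod_pow, <- (Rmult_1_l (q ^ n)).
apply Rmult_le_compat; [apply Rabs_pos | apply pow_le, Cmod_ge_0 | now apply Rabs_gbinom_le1 | ].
apply pow_incr; split; [apply Cmod_ge_0 | exact hu].
Qed.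

(** Law of exponents for powers of [1 + u]: the coefficients of the Cauchy product are collected by
    [gbinom_vandermonde]. *)
Lemma is_series_gbinom_mult (x y : R) (u sx sy : C) :
  (-1 <= x <= 1)%R -> (-1 <= y <= 1)%R -> (Cmod u < 1)%R ->
  is_series (V := C_NormedModule) (fun n => RtoC (gbinom x n) * u ^ n) sx ->
  is_series (V := C_NormedModule) (fun n => RtoC (gbinom y n) * u ^ n) sy ->
  is_series (V := C_NormedModule) (fun n => RtoC (gbinom (x + y) n) * u ^ n) (sx * sy).
Proof.
intros hx hy hu hsx hsy.
assert (h := is_series_C_mult _ _ _ _ (Cmod u) (conj (Cmod_ge_0 u) hu)
  (fun n => Cmod_gbinom_term_le x u _ n hx (Rle_refl _))
  (fun n => Cmod_gbinom_term_le y u _ n hy (Rle_refl _)) hsx hsy).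
revert h; apply is_series_ext; intros n.
rewrite <- gbinom_vandermonde.
rewrite <- (sum_n_mult_r (K := C_Ring)).
apply sum_n_ext_loc; intros i hi.
replace (u ^ n) with (u ^ i * u ^ (n - i)) by (rewrite <- Cpow_add_r; f_equal; lia).
unfold mult; simpl; ring.
Qed.

Lemma is_series_C_finite (a : nat -> C) (m : nat) (s : C) :
  (forall n, (m < n)%nat -> a n = 0) -> sum_n a m = s ->
  is_series (V := C_NormedModule) a s.
Proof.
intros ha <-; apply filterlim_ext_loc with (fun _ => sum_n a m).
2: { apply filterlim_const. }
exists m; intros n hn; induction hn as [|n hn IH]; [reflexivity | ].
rewrite sum_Sn, <- IH, ha by lia; symmetry; apply Cplus_0_r.
Qed.

Lemma gbinom_nat_large (m n : nat) : (m < n)%nat -> gbinom (INR m) n = 0%R.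
Proof.
intros h; induction h as [|n h IH].
- change (gbinom (INR m) (S m)) with (gbinom (INR m) m * (INR m - INR m) / INR (S m))%R.
  unfold Rdiv; ring.
- change (gbinom (INR m) (S n)) with (gbinom (INR m) n * (INR m - INR n) / INR (S n))%R.
  rewrite IH; unfold Rdiv; ring.
Qed.

(** The exponents add up to 0, where the binomial series reduces to its constant term. *)
Lemma sqrt1p_inv (u s r : C) :
  (Cmod u < 1)%R -> is_sqrt1p u s ->
  is_series (V := C_NormedModule) (fun n => RtoC (gbinom (- (1 / 2)) n) * u ^ n) r ->
  s * r = 1.
Proof.
intros hu hs hr.
assert (h := is_series_gbinom_mult (1 / 2)%R (- (1 / 2))%R u s r ltac:(lra) ltac:(lra) hu hs hr).
replace (1 / 2 + - (1 / 2))%R with (INR 0) in h by (simpl; ring).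
apply (is_series_C_unique _ _ _ h).
apply (is_series_C_finite _ 0).
- intros n hn; rewrite gbinom_nat_large by exact hn; ring.
- rewrite sum_O; simpl; ring.
Qed.

(** The exponents add up to 1, where only the first two terms of the binomial series survive. *)
Lemma sqrt1p_sqr (u s : C) :
  (Cmod u < 1)%R -> is_sqrt1p u s -> s * s = 1 + u.
Proof.
intros hu hs.
assert (h := is_series_gbinom_mult (1 / 2)%R (1 / 2)%R u s s ltac:(lra) ltac:(lra) hu hs hs).
replace (1 / 2 + 1 / 2)%R with (INR 1) in h by (simpl; field).
apply (is_series_C_unique _ _ _ h).
apply (is_series_C_finite _ 1).
- intros n hn; rewrite gbinom_nat_large by exact hn; ring.
- rewrite sum_Sn, sum_O; simpl.
  replace ((1 * (1 - 0) / 1)%R) with 1%R by field; unfold plus; simpl; ring.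
Qed.

Lemma ex_series_gbinom (x : R) (u : C) :
  (-1 <= x <= 1)%R -> (Cmod u < 1)%R ->
  ex_series (V := C_NormedModule) (fun n => RtoC (gbinom x n) * u ^ n).
Proof.
intros hx hu.
apply (ex_series_le (V := C_CompleteNormedModule) _ (fun n => Cmod u ^ n)%R).
- intros n; now apply Cmod_gbinom_term_le; [ | apply Rle_refl].
- apply ex_series_geom; rewrite Rabs_pos_eq; [exact hu | apply Cmod_ge_0].
Qed.

(** The bound is the exact sum of [q ^ i] for [i] from [m + 1] to [p + m], so the induction on [p]
    closes with an equality. *)
Lemma Cmod_sum_n_sub_le (a : nat -> C) (q : R) (m p : nat) :
  (0 <= q < 1)%R -> (forall n, (Cmod (a n) <= q ^ n)%R) ->
  (Cmod (sum_n a (p + m) - sum_n a m) <= (q ^ S m - q ^ S (p + m)) / (1 - q))%R.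
Proof.
intros hq ha; induction p as [|p IH].
- simpl (0 + m)%nat; replace (sum_n a m - sum_n a m) with (RtoC 0) by ring.
  rewrite Cmod_0; unfold Rdiv; lra.
- change (S p + m)%nat with (S (p + m)); rewrite (sum_Sn a).
  replace (plus _ _ - sum_n a m) with (sum_n a (p + m) - sum_n a m + a (S (p + m)))
    by (unfold plus; simpl; ring).
  eapply Rle_trans; [apply Cmod_triangle | ].
  eapply Rle_trans; [apply Rplus_le_compat; [exact IH | apply ha] | ].
  right; simpl; field; lra.
Qed.

Lemma Cmod_sum_n_le (a : nat -> C) (q : R) (m : nat) :
  (0 <= q < 1)%R -> (forall n, (Cmod (a n) <= q ^ n)%R) ->
  (Cmod (sum_n a m) <= 1 / (1 - q))%R.
Proof.
intros hq ha; assert (h0 : (0 < / (1 - q))%R) by (apply Rinv_0_lt_compat; lra).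
assert (h1 : (Cmod (sum_n a O) <= 1)%R) by (rewrite sum_O; exact (ha O)).
assert (h := Cmod_sum_n_sub_le a q O m hq ha); rewrite Nat.add_0_r in h.
replace (sum_n a m) with (sum_n a m - sum_n a O + sum_n a O) by ring.
eapply Rle_trans; [apply Cmod_triangle | ].
eapply Rle_trans; [apply Rplus_le_compat; [exact h | exact h1] | ].
assert (hp := pow_le q (S m) (proj1 hq)).
apply (Rle_trans _ ((q ^ 1 - 0) / (1 - q) + 1)).
- apply Rplus_le_compat_r, Rmult_le_compat_r; lra.
- right; field; lra.
Qed.

Lemma Cmod_series_sub_le (a : nat -> C) (q : R) (s : C) (m : nat) :
  (0 <= q < 1)%R -> (forall n, (Cmod (a n) <= q ^ n)%R) ->
  is_series (V := C_NormedModule) a s ->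
  (Cmod (s - sum_n a m) <= q ^ S m / (1 - q))%R.
Proof.
intros hq ha hs; assert (h0 : (0 < / (1 - q))%R) by (apply Rinv_0_lt_compat; lra).
apply le_epsilon; intros eps heps.
assert (hs2 : (0 < sqrt 2)%R) by (apply sqrt_lt_R0; lra).
(* A ball of [C_UniformSpace] is a square in the real and imaginary parts, so radius [d] bounds the
   modulus only by [sqrt 2 * d]. *)
assert (he : (0 < eps / sqrt 2)%R) by (apply Rdiv_lt_0_compat; lra).
destruct (proj1 (filterlim_locally (U := C_UniformSpace) (sum_n a) s) hs (mkposreal _ he)) as [n0 hn0].
assert (hn := hn0 (n0 + m)%nat ltac:(lia)).
apply C_NormedModule_mixin_compat2 in hn; simpl in hn.
replace (sqrt 2 * (eps / sqrt 2))%R with eps in hn by (field; lra).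
change (minus _ s) with (sum_n a (n0 + m) - s) in hn.
replace (s - sum_n a m) with
  ((sum_n a (n0 + m) - sum_n a m) + - (sum_n a (n0 + m) - s)) by ring.
eapply Rle_trans; [apply Cmod_triangle | ]; rewrite Cmod_opp.
apply Rplus_le_compat; [ | lra].
eapply Rle_trans; [apply (Cmod_sum_n_sub_le a q); assumption | ].
assert (hp := pow_le q (S (n0 + m)) (proj1 hq)).
apply Rmult_le_compat_r; lra.
Qed.

Lemma Cmod_series_le (a : nat -> C) (q : R) (s : C) :
  (0 <= q < 1)%R -> (forall n, (Cmod (a n) <= q ^ n)%R) ->
  is_series (V := C_NormedModule) a s ->
  (Cmod s <= 1 / (1 - q))%R.
Proof.
intros hq ha hs; assert (h1 : (Cmod (sum_n a O) <= 1)%R) by (rewrite sum_O; exact (ha O)).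
assert (h := Cmod_series_sub_le a q s O hq ha hs).
replace s with (s - sum_n a O + sum_n a O) by ring.
eapply Rle_trans; [apply Cmod_triangle | ].
eapply Rle_trans; [apply Rplus_le_compat; [exact h | exact h1] | ].
right; field; lra.
Qed.

(** * Integration over circles *)

Lemma filterlim_0_lt (T : Type) (F : (T -> Prop) -> Prop) (FF : Filter F)
    (f : T -> R) (e : R) :
  (0 < e)%R -> filterlim f F (locally 0%R) -> F (fun x => (f x < e)%R).
Proof.
intros he hf; generalize (proj1 (filterlim_locally _ _) hf (mkposreal e he)).
apply filter_imp; intros x hx.
apply (Rle_lt_trans _ (Rabs (minus (f x) 0%R))); [ | exact hx].
unfold minus, plus, opp; simpl; rewrite Ropp_0, Rplus_0_r; apply Rle_abs.
Qed.

(** * Sparse finite sums and integrals of complex-valued functions *)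

Lemma sum_n_zero (a : nat -> C) (n : nat) :
  (forall i, (i <= n)%nat -> a i = 0) -> sum_n a n = RtoC 0.
Proof.
induction n as [|n IH]; intros ha.
- rewrite sum_O; now apply ha.
- rewrite sum_Sn, IH, ha by (intros; try apply ha; lia); apply Cplus_0_l.
Qed.

Lemma sum_n_single (a : nat -> C) (i n : nat) :
  (forall l, (l <= n)%nat -> l <> i -> a l = 0) ->
  sum_n a n = if (i <=? n)%nat then a i else RtoC 0.
Proof.
induction n as [|n IH]; intros ha.
- rewrite sum_O; destruct i; simpl; [reflexivity | apply ha; lia].
- rewrite sum_Sn, IH by (intros; apply ha; lia).
  destruct (Nat.leb_spec i n); destruct (Nat.leb_spec i (S n)); try lia.
  + rewrite (ha (S n)) by lia; apply Cplus_0_r.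
  + replace i with (S n) by lia; apply Cplus_0_l.
  + rewrite (ha (S n)) by lia; apply Cplus_0_r.
Qed.

Lemma sum_n_trunc (a : nat -> C) (p d : nat) :
  (forall i, (p < i)%nat -> a i = 0) -> sum_n a (d + p) = sum_n a p.
Proof.
intros ha; induction d as [|d IH]; [reflexivity | ].
change (S d + p)%nat with (S (d + p)); rewrite sum_Sn, IH, ha by lia.
apply Cplus_0_r.
Qed.

(** Among the [N] indices following [N * J], only the last one, [N * S J], is a multiple of [N]. *)
Lemma sum_n_multiples (d : nat -> C) (N J : nat) :
  (0 < N)%nat -> (forall n, (forall j, n <> (N * j)%nat) -> d n = 0) ->
  sum_n d (N * J) = sum_n (fun j => d (N * j)%nat) J.
Proof.
intros hN hd; induction J as [|J IH].
- now rewrite Nat.mul_0_r, !sum_O, Nat.mul_0_r.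
- rewrite sum_Sn, <- IH.
  replace (N * S J)%nat with (S (pred N + N * J)) by lia.
  rewrite sum_Sn; f_equal.
  assert (h : forall i, (i < N)%nat -> sum_n d (i + N * J) = sum_n d (N * J)).
  { induction i as [|i IHi]; intros hi; [reflexivity | ].
    change (S i + N * J)%nat with (S (i + N * J)); rewrite sum_Sn, IHi by lia.
    rewrite hd; [apply Cplus_0_r | ].
    intros j e; assert (J < j)%nat by (apply (Nat.mul_lt_mono_pos_l N); lia).
    assert (j < S J)%nat by (apply (Nat.mul_lt_mono_pos_l N); lia); lia. }
  apply h; lia.
Qed.

(** Completeness is what passing to the limit under the integral requires. The class of
    [C_R_NormedModule] is reused, so integrals in the two structures agree by conversion. *)
Definition C_R_CompleteNormedModule : CompleteNormedModule R_AbsRing :=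
  CompleteNormedModule.Pack R_AbsRing C
    (CompleteNormedModule.Class R_AbsRing C (NormedModule.class R_AbsRing C_R_NormedModule)
      C_CompleteSpace_mixin) C.

(** Over [C_R_NormedModule] the scalars are real, so a complex factor is treated componentwise. *)
Lemma is_RInt_C_mult (c : C) (f : R -> C) (a b : R) (I : C) :
  is_RInt (V := C_R_NormedModule) f a b I ->
  is_RInt (V := C_R_NormedModule) (fun x => c * f x) a b (c * I).
Proof.
intros h.
assert (h1 := is_RInt_fct_extend_fst (U := R_NormedModule) (V := R_NormedModule) _ _ _ _ h).
assert (h2 := is_RInt_fct_extend_snd (U := R_NormedModule) (V := R_NormedModule) _ _ _ _ h).
apply (is_RInt_fct_extend_pair (U := R_NormedModule) (V := R_NormedModule)).
- exact (is_RInt_minus (V := R_NormedModule) _ _ _ _ _ _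
    (is_RInt_scal (V := R_NormedModule) _ _ _ (fst c) _ h1)
    (is_RInt_scal (V := R_NormedModule) _ _ _ (snd c) _ h2)).
- exact (is_RInt_plus (V := R_NormedModule) _ _ _ _ _ _
    (is_RInt_scal (V := R_NormedModule) _ _ _ (fst c) _ h2)
    (is_RInt_scal (V := R_NormedModule) _ _ _ (snd c) _ h1)).
Qed.

Lemma is_RInt_sum_n (f : nat -> R -> C) (a b : R) (I : nat -> C) (n : nat) :
  (forall i, is_RInt (V := C_R_NormedModule) (f i) a b (I i)) ->
  is_RInt (V := C_R_NormedModule) (fun x => sum_n (fun i => f i x) n) a b (sum_n I n).
Proof.
intros h; induction n as [|n IH].
- rewrite sum_O; apply (is_RInt_ext (V := C_R_NormedModule) (f O)); [ | apply h].
  intros x _; now rewrite sum_O.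
- rewrite sum_Sn.
  apply (is_RInt_ext (V := C_R_NormedModule)
    (fun x => plus (sum_n (fun i => f i x) n) (f (S n) x))).
  + intros x _; now rewrite sum_Sn.
  + exact (is_RInt_plus (V := C_R_NormedModule) _ _ _ _ _ _ IH (h (S n))).
Qed.

(** Uniform convergence also yields the convergence of the integrals [I n], which later gives that
    of the hypergeometric series. *)
Lemma is_RInt_unif_lim (f : nat -> R -> C) (g : R -> C) (I : nat -> C)
    (a b : R) (d : nat -> R) :
  (forall n, is_RInt (V := C_R_NormedModule) (f n) a b (I n)) ->
  (forall n x, (Cmod (f n x - g x) <= d n)%R) -> is_lim_seq d 0%R ->
  exists L : C, filterlim I eventually (locally (T := C_UniformSpace) L) /\
    is_RInt (V := C_R_NormedModule) g a b L.
Proof.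
intros hf hd hlim.
apply (filterlim_RInt (V := C_R_CompleteNormedModule) f a b eventually _ g I hf).
apply (filterlim_locally (U := fct_UniformSpace R C_R_CompleteNormedModule)).
intros eps; generalize (filterlim_0_lt _ _ _ _ eps (cond_pos eps) hlim).
apply filter_imp; intros n hn x.
apply C_NormedModule_mixin_compat1.
exact (Rle_lt_trans _ (d n) _ (hd n x) hn).
Qed.

(** * Powers of the circle parametrization and their integrals *)

Lemma circle_neq0 (r x : R) : (0 < r)%R -> circle r x <> 0.
Proof.
intros hr e; injection e; intros e2 e1.
assert (h := sin2_cos2 x); unfold Rsqr in h; nra.
Qed.

Lemma Cmod_circle (r x : R) : (0 < r)%R -> Cmod (circle r x) = r.
Proof.
intros hr; unfold Cmod, circle; simpl fst; simpl snd.
replace ((r * cos x) ^ 2 + (r * sin x) ^ 2)%R with (r ^ 2)%R.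
- apply sqrt_pow2; lra.
- assert (h := sin2_cos2 x); unfold Rsqr in h.
  transitivity (r ^ 2 * (sin x * sin x + cos x * cos x))%R; [rewrite h | ]; ring.
Qed.

Lemma circle_pow (r x : R) (n : nat) : circle r x ^ n = circle (r ^ n) (INR n * x).
Proof.
induction n as [|n IH].
- simpl; unfold circle; rewrite Rmult_0_l, cos_0, sin_0; apply injective_projections; simpl; ring.
- rewrite Cpow_S, IH, S_INR.
  replace ((INR n + 1) * x)%R with (x + INR n * x)%R by ring.
  unfold circle, Cmult; rewrite cos_plus, sin_plus; simpl.
  apply injective_projections; simpl; ring.
Qed.

Lemma circle_inv (r x : R) : (0 < r)%R -> / circle r x = circle (/ r) (- x).
Proof.
intros hr; apply (Cmult_eq_reg_l (circle r x)); [ | now apply circle_neq0].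
rewrite Cinv_r by now apply circle_neq0.
unfold circle, Cmult; rewrite cos_neg, sin_neg.
assert (h := sin2_cos2 x); unfold Rsqr in h.
apply injective_projections; simpl; [ | field; lra].
transitivity (sin x * sin x + cos x * cos x)%R; [now rewrite h | field; lra].
Qed.

(** The trigonometric hypotheses say that [z] is an integer; this form covers positive and negative
    exponents together. *)
Lemma is_RInt_circle (r z : R) :
  z <> 0%R -> cos (z * (2 * PI)) = 1%R -> sin (z * (2 * PI)) = 0%R ->
  is_RInt (V := C_R_NormedModule) (fun x => circle r (z * x)) 0 (2 * PI) (RtoC 0).
Proof.
intros hz hc hs.
apply (is_RInt_fct_extend_pair (U := R_NormedModule) (V := R_NormedModule)); simpl.
- evar_last.
  + apply (is_RInt_derive (V := R_CompleteNormedModule) (fun x => r / z * sin (z * x))%R).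
    * intros x _; auto_derive; [trivial | field; exact hz].
    * intros x _; apply (ex_derive_continuous (V := R_NormedModule)); auto_derive; trivial.
  + simpl; rewrite hs, (Rmult_0_r z), sin_0; unfold minus, plus, opp; simpl; ring.
- evar_last.
  + apply (is_RInt_derive (V := R_CompleteNormedModule) (fun x => - r / z * cos (z * x))%R).
    * intros x _; auto_derive; [trivial | field; exact hz].
    * intros x _; apply (ex_derive_continuous (V := R_NormedModule)); auto_derive; trivial.
  + simpl; rewrite hc, (Rmult_0_r z), cos_0; unfold minus, plus, opp; simpl; ring.
Qed.

(** Orthogonality on the circle. A Laurent monomial is encoded by two natural exponents, one for [t]
    and one for its inverse. *)
Lemma is_RInt_circle_monomial (r : R) (p q : nat) : (0 < r)%R ->
  is_RInt (V := C_R_NormedModule)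
    (fun x => circle r x ^ p * (/ circle r x) ^ q) 0 (2 * PI)
    (if (p =? q)%nat then RtoC (2 * PI) else RtoC 0).
Proof.
intros hr.
assert (hinv : forall x n, circle r x ^ n * (/ circle r x) ^ n = 1).
{ intros x n; rewrite <- Cpow_mult_l, Cinv_r by (now apply circle_neq0); apply Cpow_1_l. }
assert (hper : forall d : nat, cos (INR d * (2 * PI)) = 1%R /\ sin (INR d * (2 * PI)) = 0%R).
{ intros d; split.
  - rewrite <- cos_0, <- (cos_period 0 d); f_equal; ring.
  - rewrite <- sin_0, <- (sin_period 0 d); f_equal; ring. }
destruct (Nat.eqb_spec p q) as [<- | hpq].
- replace (RtoC (2 * PI)) with (scal (V := C_R_NormedModule) (2 * PI - 0)%R (RtoC 1)).
  2: { apply injective_projections; simpl; unfold scal; simpl; unfold mult; simpl; ring. }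
  apply (is_RInt_ext (V := C_R_NormedModule) (fun _ => RtoC 1)).
  + intros x _; now rewrite hinv.
  + apply (is_RInt_const (V := C_R_NormedModule)).
- destruct (Nat.le_gt_cases p q) as [hle | hgt].
  + apply (is_RInt_ext (V := C_R_NormedModule) (fun x => circle ((/ r) ^ (q - p)) (- INR (q - p) * x))).
    * intros x _.
      replace ((/ circle r x) ^ q) with ((/ circle r x) ^ p * (/ circle r x) ^ (q - p))
        by (rewrite <- Cpow_add_r; f_equal; lia).
      rewrite Cmult_assoc, hinv, Cmult_1_l, circle_inv, circle_pow by exact hr.
      f_equal; ring.
    * destruct (hper (q - p)%nat) as [h1 h2]; apply is_RInt_circle.
      -- apply Ropp_neq_0_compat, not_0_INR; lia.
      -- now rewrite Ropp_mult_distr_l_reverse, cos_neg.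
      -- now rewrite Ropp_mult_distr_l_reverse, sin_neg, h2, Ropp_0.
  + apply (is_RInt_ext (V := C_R_NormedModule) (fun x => circle (r ^ (p - q)) (INR (p - q) * x))).
    * intros x _.
      replace (circle r x ^ p) with (circle r x ^ (p - q) * circle r x ^ q)
        by (rewrite <- Cpow_add_r; f_equal; lia).
      now rewrite <- Cmult_assoc, hinv, Cmult_1_r, circle_pow.
    * destruct (hper (p - q)%nat) as [h1 h2]; apply is_RInt_circle; trivial.
      apply not_0_INR; lia.
Qed.

(** * The constant term *)

(* The arguments u and w of the two square roots in [on_branch]. *)
Definition arg1 (k : nat) (alpha t : C) : C := RtoC 4 * t ^ (2 * k + 1) / alpha.

Definition arg2 (k : nat) (alpha t : C) : C :=
  - (t * (RtoC 8 + RtoC 2 * alpha / t ^ (2 * k + 1)) ^ 2).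

Definition inv_sqrt_term (u : C) (n : nat) : C :=
  RtoC (gbinom (- (1 / 2)) n) * u ^ n.

(* Coefficient in inv_sqrt_term u m * inv_sqrt_term w n of the monomial
   t ^ (N m + n - N (2n - l)), coming from 8 ^ l in the expansion of w ^ n. *)
Definition laurent_coef (alpha : C) (m n l : nat) : C :=
  RtoC (gbinom (- (1 / 2)) m) * RtoC (gbinom (- (1 / 2)) n)
  * (RtoC 4 / alpha) ^ m * (- (1)) ^ n
  * (RtoC (gbinom (INR (2 * n)) l) * RtoC 8 ^ l * (RtoC 2 * alpha) ^ (2 * n - l)).

(** With [N = 2k + 1], the power [w ^ n] equals [(-1) ^ n t ^ n (8 + 2 alpha / t ^ N) ^ (2n)], and
    the last factor is expanded by the binomial theorem. *)
Lemma term_mult_laurent (k : nat) (alpha t : C) (m n : nat) :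
  alpha <> 0 -> t <> 0 ->
  inv_sqrt_term (arg1 k alpha t) m * inv_sqrt_term (arg2 k alpha t) n =
  sum_n (fun l => laurent_coef alpha m n l *
    (t ^ ((2 * k + 1) * m + n) * (/ t) ^ ((2 * k + 1) * (2 * n - l)))) (2 * n).
Proof.
intros ha ht; unfold inv_sqrt_term.
set (N := (2 * k + 1)%nat).
assert (h1 : arg1 k alpha t ^ m = (RtoC 4 / alpha) ^ m * t ^ (N * m)).
{ rewrite (Cpow_mult_r t), <- Cpow_mult_l; f_equal; unfold arg1, Cdiv; fold N; ring. }
assert (h2 : arg2 k alpha t ^ n = (- (1)) ^ n * t ^ n *
  (RtoC 8 + RtoC 2 * alpha * (/ t) ^ N) ^ (2 * n)).
{ rewrite (Cpow_mult_r _ 2), <- !Cpow_mult_l; f_equal.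
  rewrite Cpow_inv by exact ht; unfold arg2, Cdiv; fold N; ring. }
rewrite h1, h2, Cpow_binomial, Cmult_assoc, Cmult_assoc.
rewrite <- (sum_n_mult_l (K := C_Ring)).
apply sum_n_ext; intros l; unfold laurent_coef, mult; simpl (Ring.mult _ _).
rewrite (Cpow_mult_l (RtoC 2 * alpha)), <- (Cpow_mult_r _ N), Cpow_add_r.
simpl; ring.
Qed.

Definition term_integral (k : nat) (alpha : C) (m n : nat) : C :=
  sum_n (fun l => laurent_coef alpha m n l *
    (if ((2 * k + 1) * m + n =? (2 * k + 1) * (2 * n - l))%nat
     then RtoC (2 * PI) else 0)) (2 * n).

Lemma is_RInt_term (k : nat) (alpha : C) (r : R) (m n : nat) :
  alpha <> 0 -> (0 < r)%R ->
  is_RInt (V := C_R_NormedModule)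
    (fun x => inv_sqrt_term (arg1 k alpha (circle r x)) m *
              inv_sqrt_term (arg2 k alpha (circle r x)) n)
    0 (2 * PI) (term_integral k alpha m n).
Proof.
intros ha hr.
apply (is_RInt_ext (V := C_R_NormedModule) (fun x =>
  sum_n (fun l => laurent_coef alpha m n l *
    (circle r x ^ ((2 * k + 1) * m + n) *
     (/ circle r x) ^ ((2 * k + 1) * (2 * n - l)))) (2 * n))).
- intros x _; rewrite term_mult_laurent; auto using circle_neq0.
- apply is_RInt_sum_n; intros l; now apply is_RInt_C_mult, is_RInt_circle_monomial.
Qed.

Lemma term_integral_not_multiple (k : nat) (alpha : C) (m n : nat) :
  (forall j, n <> ((2 * k + 1) * j)%nat) -> term_integral k alpha m n = 0.
Proof.
intros hn; apply sum_n_zero; intros l hl.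
destruct (Nat.eqb_spec ((2 * k + 1) * m + n) ((2 * k + 1) * (2 * n - l))) as [e | _];
  [ | ring].
(* The equality of exponents gives [n = N (2n - l - m)]; it also gives [m <= 2n - l], so the
   subtraction is not truncated. *)
exfalso; apply (hn (2 * n - l - m)%nat); rewrite Nat.mul_sub_distr_l; lia.
Qed.

(** Here [2n - l = j + m], so [alpha ^ (j + m)] meets [alpha ^ (-m)] and [4 ^ m * 2 ^ m] completes
    [8 ^ (p - m)]. Only the two binomials still depend on [m]. *)
Lemma laurent_coef_diag (k : nat) (alpha : C) (j m : nat) :
  alpha <> 0 ->
  let n := ((2 * k + 1) * j)%nat in
  let p := ((4 * k + 1) * j)%nat in
  (m <= p)%nat ->
  laurent_coef alpha m n (p - m) =
  RtoC (gbinom (- (1 / 2)) m) * RtoC (gbinom (INR (2 * n)) (p - m)) *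
  (RtoC ((- 1) ^ n * gbinom (- (1 / 2)) n * 8 ^ p * 2 ^ j) * alpha ^ j).
Proof.
intros ha n p hm; unfold laurent_coef.
replace (2 * n - (p - m))%nat with (j + m)%nat by (unfold n, p in *; lia).
replace (8 ^ p)%R with (8 ^ (p - m) * (4 ^ m * 2 ^ m))%R.
2: { rewrite <- Rpow_mult_distr; replace (4 * 2)%R with 8%R by ring.
  rewrite <- pow_add; f_equal; lia. }
rewrite !RtoC_mult, !RtoC_pow, !Cpow_mult_l, !Cpow_add_r.
unfold Cdiv; rewrite Cpow_mult_l.
replace (RtoC (-1)) with (- RtoC 1) by (rewrite <- RtoC_opp; f_equal; lra).
assert (hi : alpha ^ m * (/ alpha) ^ m = 1).
{ rewrite <- Cpow_mult_l, Cinv_r by exact ha; apply Cpow_1_l. }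
match goal with |- ?l = ?r => transitivity (r * (alpha ^ m * (/ alpha) ^ m)) end.
- ring.
- rewrite hi; ring.
Qed.

(** For fixed [n = N j], each [m <= p] contributes only through [l = p - m], and the sum over [m] is
    a Chu-Vandermonde convolution. *)
Lemma sum_term_integral_multiple (k : nat) (alpha : C) (j M : nat) :
  alpha <> 0 -> (2 * ((2 * k + 1) * j) <= M)%nat ->
  sum_n (fun m => term_integral k alpha m ((2 * k + 1) * j)) M =
  RtoC (2 * PI) * (RtoC (Ihat_coef k j) * alpha ^ j).
Proof.
intros ha hM.
set (n := ((2 * k + 1) * j)%nat); set (p := ((4 * k + 1) * j)%nat).
assert (hp : (p + j = 2 * n)%nat) by (unfold n, p; lia).
assert (hval : forall m, term_integral k alpha m n =
  if (m <=? p)%nat then laurent_coef alpha m n (p - m) * RtoC (2 * PI) else 0).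
{ intros m; unfold term_integral.
  (* Cancelling [N] leaves [m + j = 2n - l], which is [l + m = p] because [p + j = 2n]. *)
  assert (hcond : forall l, (l <= 2 * n)%nat ->
    ((2 * k + 1) * m + n = (2 * k + 1) * (2 * n - l))%nat <-> (l + m = p)%nat).
  { intros l hl; unfold n at 1; rewrite <- Nat.mul_add_distr_l.
    rewrite Nat.mul_cancel_l by lia; fold n; lia. }
  destruct (Nat.leb_spec m p) as [hm | hm].
  - rewrite (sum_n_single _ (p - m)).
    + destruct (Nat.leb_spec (p - m) (2 * n)); [ | lia].
      replace (_ =? _)%nat with true; [reflexivity | ].
      symmetry; apply Nat.eqb_eq, hcond; lia.
    + intros l hl hne.
      destruct (Nat.eqb_spec ((2 * k + 1) * m + n) ((2 * k + 1) * (2 * n - l))) as [e | _];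
        [apply hcond in e; lia | ring].
  - apply sum_n_zero; intros l hl.
    destruct (Nat.eqb_spec ((2 * k + 1) * m + n) ((2 * k + 1) * (2 * n - l))) as [e | _];
      [apply hcond in e; lia | ring]. }
rewrite (sum_n_ext _ _ _ hval).
(* As [p <= 2n <= M], the sum contains the whole convolution, and its terms beyond [p] vanish. *)
replace M with ((M - p) + p)%nat by lia.
rewrite sum_n_trunc.
2: { intros i hi; destruct (Nat.leb_spec i p); [lia | reflexivity]. }
rewrite Ihat_coef_gbinom; fold n p.
replace (INR (2 * n) - 1 / 2)%R with (- (1 / 2) + INR (2 * n))%R by ring.
rewrite (RtoC_mult _ (gbinom _ p)), <- gbinom_vandermonde.
set (c := RtoC ((- 1) ^ n * gbinom (- (1 / 2)) n * 8 ^ p * 2 ^ j)).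
transitivity (sum_n (fun i => mult (RtoC (gbinom (- (1 / 2)) i) *
  RtoC (gbinom (INR (2 * n)) (p - i))) (c * alpha ^ j * RtoC (2 * PI))) p).
- apply sum_n_ext_loc; intros m hm.
  destruct (Nat.leb_spec m p); [ | lia].
  assert (e := laurent_coef_diag k alpha j m ha hm); cbv zeta in e; fold n p c in e.
  rewrite e; change (@mult C_Ring) with Cmult.
  ring_C.
- transitivity (sum_n (fun i => RtoC (gbinom (- (1 / 2)) i) *
    RtoC (gbinom (INR (2 * n)) (p - i))) p * (c * alpha ^ j * RtoC (2 * PI)));
    [apply (sum_n_mult_r (K := C_Ring)) | ].
  ring_C.
Qed.

(** The range of [m] is long enough for every [j <= J], so no inner convolution is cut short. *)
Lemma sum_term_integral (k : nat) (alpha : C) (J : nat) :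
  alpha <> 0 ->
  sum_n (fun n => sum_n (fun m => term_integral k alpha m n)
    (2 * ((2 * k + 1) * J))) ((2 * k + 1) * J) =
  RtoC (2 * PI) * sum_n (fun j => RtoC (Ihat_coef k j) * alpha ^ j) J.
Proof.
intros ha; rewrite sum_n_multiples.
- rewrite <- (sum_n_mult_l (K := C_Ring)).
  apply sum_n_ext_loc; intros j hj; apply sum_term_integral_multiple; [exact ha | ].
  apply Nat.mul_le_mono_l, Nat.mul_le_mono_l, hj.
- lia.
- intros n hn; apply sum_n_zero; intros m _; now apply term_integral_not_multiple.
Qed.

Lemma sum_n_mult (a b : nat -> C) (M n : nat) :
  sum_n (fun i => sum_n (fun m => a m * b i) M) n = sum_n a M * sum_n b n.
Proof.
rewrite <- (sum_n_mult_l (K := C_Ring)); apply sum_n_ext; intros i.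
apply (sum_n_mult_r (K := C_Ring)).
Qed.

Lemma is_RInt_partial_product (k : nat) (alpha : C) (r : R) (M n : nat) :
  alpha <> 0 -> (0 < r)%R ->
  is_RInt (V := C_R_NormedModule)
    (fun x => sum_n (inv_sqrt_term (arg1 k alpha (circle r x))) M *
              sum_n (inv_sqrt_term (arg2 k alpha (circle r x))) n)
    0 (2 * PI) (sum_n (fun i => sum_n (fun m => term_integral k alpha m i) M) n).
Proof.
intros ha hr.
apply (is_RInt_ext (V := C_R_NormedModule) (fun x =>
  sum_n (fun i => sum_n (fun m => inv_sqrt_term (arg1 k alpha (circle r x)) m *
    inv_sqrt_term (arg2 k alpha (circle r x)) i) M) n)).
- intros x _; apply sum_n_mult.
- apply is_RInt_sum_n; intros i; apply is_RInt_sum_n; intros m; now apply is_RInt_term.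
Qed.

(** Replacing one factor at a time leaves two products of a tail with a bounded factor; [n <= M]
    bounds both tails by [q ^ n / (1 - q)]. *)
Lemma partial_product_error (a b : nat -> C) (sa sb : C) (q : R) (M n : nat) :
  (0 <= q < 1)%R ->
  (forall i, (Cmod (a i) <= q ^ i)%R) -> (forall i, (Cmod (b i) <= q ^ i)%R) ->
  is_series (V := C_NormedModule) a sa -> is_series (V := C_NormedModule) b sb ->
  (n <= M)%nat ->
  (Cmod (sum_n a M * sum_n b n - sa * sb) <= 2 * (1 / (1 - q)) ^ 2 * q ^ n)%R.
Proof.
intros hq ha hb hsa hsb hn.
assert (h0 : (0 < / (1 - q))%R) by (apply Rinv_0_lt_compat; lra).
replace (sum_n a M * sum_n b n - sa * sb) with
  (- ((sa - sum_n a M) * sum_n b n) + - (sa * (sb - sum_n b n))) by ring.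
eapply Rle_trans; [apply Cmod_triangle | ]; rewrite !Cmod_opp, !Cmod_mult.
assert (e1 := Cmod_series_sub_le a q sa M hq ha hsa).
assert (e2 := Cmod_series_sub_le b q sb n hq hb hsb).
assert (e3 := Cmod_series_le a q sa hq ha hsa).
assert (e4 := Cmod_sum_n_le b q n hq hb).
replace (2 * (1 / (1 - q)) ^ 2 * q ^ n)%R with
  (q ^ n / (1 - q) * (1 / (1 - q)) + 1 / (1 - q) * (q ^ n / (1 - q)))%R
  by (field; lra).
apply Rplus_le_compat; apply Rmult_le_compat; try apply Cmod_ge_0; try assumption;
  (eapply Rle_trans; [eassumption | ]); apply Rmult_le_compat_r; try lra;
  apply pow_le_pow_exp; (lra || lia).
Qed.

(* The convergence of the series for Ihat is part of the conclusion: its partial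
   sums are the integrals of the partial products. *)
Lemma period_integral (k : nat) (alpha : C) (r q : R) (s : R -> C) :
  alpha <> 0 -> (0 < r)%R -> (0 <= q < 1)%R ->
  (forall x, (Cmod (arg1 k alpha (circle r x)) <= q)%R) ->
  (forall x, (Cmod (arg2 k alpha (circle r x)) <= q)%R) ->
  (forall x, exists s1 s2 : C,
    is_sqrt1p (arg1 k alpha (circle r x)) s1 /\
    is_sqrt1p (arg2 k alpha (circle r x)) s2 /\ s x = s1 * s2) ->
  exists v : C, is_Ihat k alpha v /\
    is_RInt (V := C_R_NormedModule) (fun x => / s x) 0 (2 * PI) (RtoC (2 * PI) * v).
Proof.
intros ha hr hq h1 h2 hs.
assert (hh : (-1 <= - (1 / 2) <= 1)%R) by lra.
destruct (is_RInt_unif_lim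
  (fun J x => sum_n (inv_sqrt_term (arg1 k alpha (circle r x))) (2 * ((2 * k + 1) * J)) *
    sum_n (inv_sqrt_term (arg2 k alpha (circle r x))) ((2 * k + 1) * J))
  (fun x => / s x)
  (fun J => RtoC (2 * PI) * sum_n (fun j => RtoC (Ihat_coef k j) * alpha ^ j) J)
  0 (2 * PI) (fun J => 2 * (1 / (1 - q)) ^ 2 * q ^ J)%R) as [L [hL hI]].
- intros J; rewrite <- sum_term_integral by exact ha.
  now apply is_RInt_partial_product.
- intros J x; destruct (hs x) as [s1 [s2 [hs1 [hs2 e]]]]; rewrite e.
  specialize (h1 x); specialize (h2 x).
  assert (hu1 : (Cmod (arg1 k alpha (circle r x)) < 1)%R) by lra.
  assert (hu2 : (Cmod (arg2 k alpha (circle r x)) < 1)%R) by lra.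
  destruct (ex_series_gbinom (- (1 / 2)) _ hh hu1) as [r1 hr1].
  destruct (ex_series_gbinom (- (1 / 2)) _ hh hu2) as [r2 hr2].
  assert (e1 := sqrt1p_inv _ _ _ hu1 hs1 hr1).
  assert (e2 := sqrt1p_inv _ _ _ hu2 hs2 hr2).
  (* [r1] and [r2] are the sums of the series with exponent -1/2, inverse to the two square
     roots. *)
  replace (/ (s1 * s2)) with (r1 * r2).
  2: { assert (hne : s1 * s2 <> 0).
    { intros h; apply C1_nz; transitivity (s1 * r1 * (s2 * r2)); [rewrite e1, e2; ring | ].
      transitivity (s1 * s2 * (r1 * r2)); [ring | rewrite h; ring]. }
    apply (Cmult_eq_reg_l (s1 * s2)); [ | exact hne].
    rewrite Cinv_r by exact hne.
    transitivity (s1 * r1 * (s2 * r2)); [ring | rewrite e1, e2; ring]. }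
  eapply Rle_trans.
  + apply (partial_product_error _ _ r1 r2 q); [exact hq | | | exact hr1 | exact hr2 | lia];
      intros i; now apply Cmod_gbinom_term_le.
  + apply Rmult_le_compat_l.
    * apply Rmult_le_pos; [lra | apply pow2_ge_0].
    * apply pow_le_pow_exp; [lra | lia].
- replace (Finite 0) with (Rbar_mult (2 * (1 / (1 - q)) ^ 2)%R 0%R)
    by (simpl; f_equal; ring).
  apply is_lim_seq_scal_l, is_lim_seq_geom; rewrite Rabs_pos_eq; lra.
- assert (hpi : RtoC (2 * PI) <> 0).
  { intros e; apply RtoC_inj in e; assert (h := PI_RGT_0); lra. }
  (* [L] is the limit of the integrals, that is, of [2 PI] times the partial sums. *)
  exists (/ RtoC (2 * PI) * L); split.
  + unfold is_Ihat, is_series.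
    apply (filterlim_ext (fun J => / RtoC (2 * PI) *
      (RtoC (2 * PI) * sum_n (fun j => RtoC (Ihat_coef k j) * alpha ^ j) J))).
    { intros J; rewrite Cmult_assoc, Cinv_l by exact hpi; apply Cmult_1_l. }
    exact (filterlim_comp _ _ _ _ _ _ _ _ hL
      (filterlim_scal_r (K := C_AbsRing) (V := C_NormedModule) (/ RtoC (2 * PI)) L)).
  + rewrite Cmult_assoc, Cinv_r, Cmult_1_l by exact hpi; exact hI.
Qed.

(** * The cycle *)

Lemma Rpower_div_pow (r a : R) (n : nat) : (0 < r)%R ->
  (Rpower r (a / INR (S n)) ^ S n = Rpower r a)%R.
Proof.
intros hr; rewrite <- Rpower_pow by apply exp_pos.
rewrite Rpower_mult; f_equal; field; now apply not_0_INR.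
Qed.

(** Put [x = rho r / r ^ (1/(2k+1))] and [z = r ^ (2/(4k+1)) / rho r], both small. The first bounded
    quantity is [4 x ^ (2k+1)], the second is at most [128 rho r + 8 z ^ (4k+1)]. *)
Lemma admissible_radius_small (k : nat) (rho : R -> R) :
  admissible_radius k rho ->
  exists eps : R, (0 < eps)%R /\ forall r : R, (0 < r < eps)%R ->
    (0 < rho r /\ 4 * rho r ^ (2 * k + 1) / r <= 1 / 2 /\
     rho r * (8 + 2 * r / rho r ^ (2 * k + 1)) ^ 2 <= 1 / 2)%R.
Proof.
intros [_ [hpos [hlow hup]]].
(* The constants make both [8 z] and [128 rho r] at most 1/4. *)
assert (h1 := filterlim_0_lt _ (at_right 0%R) _ _ (1 / 32) ltac:(lra) hlow).
assert (h2 := filterlim_0_lt _ (at_right 0%R) _ _ (1 / 512) ltac:(lra) hup).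
destruct (filter_and _ _ hpos (filter_and _ _ h1 h2)) as [d hd].
(* Keeping [r] below 1 gives [s <= 1], so that [p = x * s] inherits the smallness of [x]. *)
exists (Rmin d 1); split; [apply Rmin_pos; [apply cond_pos | lra] | ].
intros r [hr hrd].
assert (hr1 := Rlt_le_trans _ _ _ hrd (Rmin_r _ _)).
assert (hrd' := Rlt_le_trans _ _ _ hrd (Rmin_l _ _)).
destruct (hd r) as [hp [hz hx]].
{ change (Rabs (r - 0) < d)%R; rewrite Rminus_0_r, Rabs_pos_eq; lra. }
{ exact hr. }
clear hd hrd hrd' h1 h2 hpos hlow hup.
replace (2 * k + 1)%nat with (S (2 * k)) in * by lia.
replace (4 * k + 1)%nat with (S (4 * k)) in * by lia.
set (p := rho r) in *; set (s := Rpower r (1 / INR (S (2 * k)))) in *.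
set (z0 := Rpower r (2 / INR (S (4 * k)))) in *.
assert (hs : (s ^ S (2 * k) = r)%R).
{ unfold s; rewrite Rpower_div_pow by exact hr; now apply Rpower_1. }
assert (hz0 : (z0 ^ S (4 * k) = r ^ 2)%R).
{ unfold z0; rewrite Rpower_div_pow by exact hr; now apply (Rpower_pow 2). }
assert (s0 : (0 < s)%R) by apply exp_pos.
assert (z00 : (0 < z0)%R) by apply exp_pos.
set (x := (p / s)%R) in *; set (z := (z0 / p)%R) in *.
assert (x0 : (0 < x)%R) by now apply Rdiv_lt_0_compat.
assert (zp : (0 < z)%R) by now apply Rdiv_lt_0_compat.
assert (s1 : (s <= 1)%R).
{ destruct (Rle_lt_dec s 1) as [h | h]; [exact h | exfalso].
  assert (h' := Rlt_pow_R1 s (S (2 * k)) h ltac:(lia)); lra. }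
assert (hpx : p = (x * s)%R) by (unfold x; field; lra).
assert (hzp : z0 = (z * p)%R) by (unfold z; field; lra).
assert (hpow : (0 < p ^ S (2 * k))%R) by now apply pow_lt.
split; [exact hp | split].
- replace (4 * p ^ S (2 * k) / r)%R with (4 * x ^ S (2 * k))%R.
  + assert (h := pow_le_pow_exp x 1 (S (2 * k)) ltac:(lra) ltac:(lia)); lra.
  + rewrite hpx, Rpow_mult_distr, hs; field; lra.
- apply (Rle_trans _ (128 * p + 8 * z ^ S (4 * k))%R).
  + apply (Rle_trans _ (p * (128 + 8 * (r / p ^ S (2 * k)) ^ 2))%R).
    * (* (a + b)^2 <= 2 a^2 + 2 b^2 *)
      apply Rmult_le_compat_l; [lra | ].
      unfold Rdiv at 1; rewrite Rmult_assoc; fold (r / p ^ S (2 * k))%R.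
      assert (h := pow2_ge_0 (8 - 2 * (r / p ^ S (2 * k)))); nra.
    * right; apply (Rmult_eq_reg_r (p ^ S (4 * k))).
      2: { apply pow_nonzero; lra. }
      rewrite Rmult_plus_distr_r, (Rmult_assoc 8), <- Rpow_mult_distr, <- hzp, hz0.
      replace (p ^ S (4 * k))%R with (p ^ S (2 * k) * p ^ S (2 * k) / p)%R.
      -- field; lra.
      -- rewrite <- pow_add; replace (S (2 * k) + S (2 * k))%nat with (S (S (4 * k))) by lia.
         simpl; field; lra.
  + assert (h := pow_le_pow_exp z 1 (S (4 * k)) ltac:(lra) ltac:(lia)).
    assert (p <= 1 / 512)%R by nra.
    lra.
Qed.

(** * Continuity of complex-valued functions and of the square root *)

Lemma continuous_prod (T U V : UniformSpace) (f : T -> U) (g : T -> V) (x : T) :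
  continuous f x -> continuous g x -> continuous (fun y => (f y, g y)) x.
Proof.
intros hf hg; apply filterlim_locally; intros eps.
generalize (filter_and _ _ (proj1 (filterlim_locally _ _) hf eps)
  (proj1 (filterlim_locally _ _) hg eps)).
apply filter_imp; intros y [h1 h2]; split; assumption.
Qed.

Lemma continuous_Re (f : R -> C) (x : R) :
  continuous (U := C_UniformSpace) f x -> continuous (fun y => Re (f y)) x.
Proof.
intros hf; apply filterlim_locally; intros eps.
generalize (proj1 (filterlim_locally (U := C_UniformSpace) _ _) hf eps).
apply filter_imp; intros y h; apply h.
Qed.

Lemma continuous_Im (f : R -> C) (x : R) :
  continuous (U := C_UniformSpace) f x -> continuous (fun y => Im (f y)) x.
Proof.
intros hf; apply filterlim_locally; intros eps.
generalize (proj1 (filterlim_locally (U := C_UniformSpace) _ _) hf eps).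
apply filter_imp; intros y h; apply h.
Qed.

Lemma continuous_C (f : R -> C) (x : R) :
  continuous (fun y => Re (f y)) x -> continuous (fun y => Im (f y)) x ->
  continuous (U := C_UniformSpace) f x.
Proof.
intros h1 h2; apply filterlim_locally; intros eps.
generalize (filter_and _ _ (proj1 (filterlim_locally _ _) h1 eps)
  (proj1 (filterlim_locally _ _) h2 eps)).
apply filter_imp; intros y [e1 e2]; split; assumption.
Qed.

Lemma continuous_Cplus (f g : R -> C) (x : R) :
  continuous (U := C_UniformSpace) f x -> continuous (U := C_UniformSpace) g x ->
  continuous (U := C_UniformSpace) (fun y => f y + g y) x.
Proof.
intros hf hg; apply continuous_C; apply (continuous_plus (V := R_NormedModule));
  auto using continuous_Re, continuous_Im.
Qed.

Lemma continuous_Cmult (f g : R -> C) (x : R) :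
  continuous (U := C_UniformSpace) f x -> continuous (U := C_UniformSpace) g x ->
  continuous (U := C_UniformSpace) (fun y => f y * g y) x.
Proof.
intros hf hg; apply continuous_C.
- apply (continuous_minus (V := R_NormedModule)); apply (continuous_mult (K := R_AbsRing));
    auto using continuous_Re, continuous_Im.
- apply (continuous_plus (V := R_NormedModule)); apply (continuous_mult (K := R_AbsRing));
    auto using continuous_Re, continuous_Im.
Qed.

Lemma continuous_Cpow (f : R -> C) (n : nat) (x : R) :
  continuous (U := C_UniformSpace) f x ->
  continuous (U := C_UniformSpace) (fun y => f y ^ n) x.
Proof.
intros hf; induction n as [|n IH]; [apply continuous_const | ].
now apply (continuous_Cmult f (fun y => f y ^ n)).
Qed.

Lemma continuous_sum_n (f : nat -> R -> C) (n : nat) (x : R) :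
  (forall i, continuous (U := C_UniformSpace) (f i) x) ->
  continuous (U := C_UniformSpace) (fun y => sum_n (fun i => f i y) n : C) x.
Proof.
intros hf; induction n as [|n IH].
- apply (continuous_ext (f O)); [ | apply hf]; intros y; now rewrite sum_O.
- apply (continuous_ext (fun y => (sum_n (fun i => f i y) n : C) + f (S n) y)).
  + intros y; now rewrite sum_Sn.
  + now apply continuous_Cplus.
Qed.

(** The usual three-epsilon argument, through a single [f n] close to [g] everywhere. *)
Lemma continuous_unif_lim (f : nat -> R -> C) (g : R -> C) (d : nat -> R) (x : R) :
  (forall n, continuous (U := C_UniformSpace) (f n) x) ->
  (forall n y, (Cmod (g y - f n y) <= d n)%R) -> is_lim_seq d 0%R ->
  continuous (U := C_UniformSpace) g x.
Proof.
intros hf hd hlim; apply filterlim_locally; intros eps.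
assert (he : (0 < eps / 3)%R) by (assert (h := cond_pos eps); lra).
destruct (filterlim_0_lt _ _ _ _ (eps / 3) he hlim) as [n hn].
specialize (hn n (Nat.le_refl n)).
assert (hball : forall y, ball (M := C_UniformSpace) (f n y) (eps / 3) (g y)).
{ intros y; apply C_NormedModule_mixin_compat1.
  exact (Rle_lt_trans _ (d n) _ (hd n y) hn). }
generalize (proj1 (filterlim_locally (U := C_UniformSpace) _ _) (hf n) (mkposreal _ he)).
apply filter_imp; intros y hy.
replace (pos eps) with (eps / 3 + eps / 3 + eps / 3)%R by field.
apply (ball_triangle (M := C_UniformSpace)) with (f n y); [ | apply hball].
apply (ball_triangle (M := C_UniformSpace)) with (f n x); [ | exact hy].
apply ball_sym, hball.
Qed.

(** Turns the relation into a function by unique description; its value is meaningful only where the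
    binomial series converges. *)
Definition sqrt1p (u : C) : C := iota (T := C_CompleteNormedModule) (is_sqrt1p u).

Lemma sqrt1p_correct (u : C) : (Cmod u < 1)%R -> is_sqrt1p u (sqrt1p u).
Proof.
intros hu; apply (iota_correct (V := C_CompleteNormedModule) (is_sqrt1p u)).
destruct (ex_series_gbinom (1 / 2) u ltac:(lra) hu) as [s hs].
exists s; split; [exact hs | intros s' hs'; exact (is_series_C_unique _ _ _ hs hs')].
Qed.

(** The partial sums are polynomials in [f], and the bound [q < 1] makes their geometric tails
    uniform. *)
Lemma continuous_sqrt1p (f : R -> C) (q : R) (x : R) :
  (0 <= q < 1)%R -> (forall y, (Cmod (f y) <= q)%R) ->
  continuous (U := C_UniformSpace) f x ->
  continuous (U := C_UniformSpace) (fun y => sqrt1p (f y)) x.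
Proof.
intros hq hf hc.
apply (continuous_unif_lim
  (fun n y => sum_n (fun i => RtoC (gbinom (1 / 2) i) * f y ^ i) n) _
  (fun n => / (1 - q) * q ^ S n)%R).
- intros n; apply continuous_sum_n; intros i.
  apply continuous_Cmult; [apply continuous_const | now apply continuous_Cpow].
- intros n y; rewrite Rmult_comm.
  apply (Cmod_series_sub_le (fun i => RtoC (gbinom (1 / 2) i) * f y ^ i) q); [exact hq | | ].
  + intros i; apply Cmod_gbinom_term_le; [lra | apply hf].
  + apply sqrt1p_correct, (Rle_lt_trans _ q); [apply hf | lra].
- replace (Finite 0) with (Rbar_mult (/ (1 - q))%R 0%R) by (simpl; f_equal; ring).
  apply is_lim_seq_scal_l; apply -> (is_lim_seq_incr_1 (fun n => q ^ n)%R).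
  apply is_lim_seq_geom; rewrite Rabs_pos_eq; lra.
Qed.

Lemma continuous_circle (r z x : R) :
  continuous (U := C_UniformSpace) (fun y => circle r (z * y)) x.
Proof.
apply continuous_C; simpl; apply (ex_derive_continuous (V := R_NormedModule));
  auto_derive; trivial.
Qed.

Lemma circle_period (r x : R) : circle r (x + 2 * PI) = circle r x.
Proof.
unfold circle; replace (x + 2 * PI)%R with (x + 2 * INR 1 * PI)%R by (simpl; ring).
now rewrite cos_period, sin_period.
Qed.

Lemma is_derive_circle (r x : R) :
  is_derive (V := C_R_NormedModule) (circle r) x (Ci * circle r x).
Proof.
apply (is_derive_ext (V := C_R_NormedModule) (fun y =>
  plus (scal (r * cos y)%R (RtoC 1 : C_R_NormedModule)) (scal (r * sin y)%R (Ci : C_R_NormedModule)))).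
{ intros y; apply injective_projections; simpl; unfold plus, scal; simpl;
    unfold mult; simpl; ring. }
evar_last.
- apply (is_derive_plus (V := C_R_NormedModule)); apply (is_derive_scal_l (V := C_R_NormedModule));
    auto_derive; [trivial | reflexivity | trivial | reflexivity].
- apply injective_projections; simpl; unfold plus, scal; simpl; unfold mult; simpl; ring.
Qed.

(** * Construction of the cycle and evaluation of its period *)

Lemma Cmod_arg1_le (k : nat) (alpha t : C) (q : R) :
  alpha <> 0 -> (4 * Cmod t ^ (2 * k + 1) / Cmod alpha <= q)%R ->
  (Cmod (arg1 k alpha t) <= q)%R.
Proof.
intros ha h; unfold arg1.
now rewrite Cmod_div, Cmod_mult, Cmod_R, Cmod_pow, Rabs_pos_eq by (trivial || lra).
Qed.

Lemma Cmod_arg2_le (k : nat) (alpha t : C) (q : R) : t <> 0 ->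
  (Cmod t * (8 + 2 * Cmod alpha / Cmod t ^ (2 * k + 1)) ^ 2 <= q)%R ->
  (Cmod (arg2 k alpha t) <= q)%R.
Proof.
intros ht h; unfold arg2; rewrite Cmod_opp, Cmod_mult, Cmod_pow.
eapply Rle_trans; [ | exact h]; apply Rmult_le_compat_l; [apply Cmod_ge_0 | ].
apply pow_incr; split; [apply Cmod_ge_0 | ].
eapply Rle_trans; [apply Cmod_triangle | ].
rewrite Cmod_div, Cmod_mult, !Cmod_R, Cmod_pow, !Rabs_pos_eq by (lra || now apply Cpow_nz).
apply Rle_refl.
Qed.

Lemma branch_on_curve (k : nat) (alpha t s1 s2 : C) :
  alpha <> 0 -> t <> 0 ->
  s1 * s1 = 1 + arg1 k alpha t -> s2 * s2 = 1 + arg2 k alpha t ->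
  chart_curve k alpha (t, t ^ (2 * k + 1) * s1 * s2).
Proof.
intros ha ht h1 h2; split; cbn [fst snd].
- intros [e _]; exact (C1_nz e).
- assert (hT : t ^ (2 * k + 1) <> 0) by now apply Cpow_nz.
  assert (hP : t * t ^ (4 * k + 1) = t ^ (2 * k + 1) * t ^ (2 * k + 1)).
  { rewrite <- Cpow_S, <- Cpow_add_r; f_equal; lia. }
  assert (hQ : t ^ (4 * k + 2) = t ^ (2 * k + 1) * t ^ (2 * k + 1)).
  { rewrite <- Cpow_add_r; f_equal; lia. }
  unfold h; rewrite !Cpow_1_l, hQ.
  unfold arg1 in h1; unfold arg2 in h2.
  revert hT hP h1 h2; generalize (t ^ (2 * k + 1)) (t ^ (4 * k + 1)); intros T P hT hP h1 h2.
  transitivity (alpha * (T * T) * (s1 * s1) * (s2 * s2)); [ring | ].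
  rewrite h1, h2.
  (* Clearing the denominators [alpha] and [T]; then [T * T = t * P] lets a factor [t] come out, as
     in [h]. *)
  transitivity ((alpha + RtoC 4 * T) *
    (T * T - t * (RtoC 8 * T + RtoC 2 * alpha) ^ 2)); [field; split; assumption | ].
  transitivity ((alpha + RtoC 4 * T) *
    (t * P - t * (RtoC 8 * T + RtoC 2 * alpha) ^ 2)); [now rewrite hP | ring].
Qed.

(** The branch formula itself defines the lift: it depends only on [t], so the path closes up. This
    keeps the claim about all such cycles from being vacuous. *)
Lemma is_gamma_exists (k : nat) (rho : R -> R) (alpha : C) (q : R) :
  alpha <> 0 -> (0 < rho (Cmod alpha))%R -> (0 <= q < 1)%R ->
  (forall x, (Cmod (arg1 k alpha (circle (rho (Cmod alpha)) x)) <= q)%R) ->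
  (forall x, (Cmod (arg2 k alpha (circle (rho (Cmod alpha)) x)) <= q)%R) ->
  exists g : R -> C * C, is_gamma k rho alpha g.
Proof.
intros ha hr hq h1 h2; set (r := rho (Cmod alpha)) in *.
assert (hu1 : forall x, (Cmod (arg1 k alpha (circle r x)) < 1)%R).
{ intros x; specialize (h1 x); lra. }
assert (hu2 : forall x, (Cmod (arg2 k alpha (circle r x)) < 1)%R).
{ intros x; specialize (h2 x); lra. }
assert (hc : forall x, continuous (U := C_UniformSpace) (circle r) x).
{ intros x; apply (continuous_ext (fun y => circle r (1 * y))); [ | apply continuous_circle].
  intros y; now rewrite Rmult_1_l. }
assert (hpow : forall x, continuous (U := C_UniformSpace) (fun y => circle r y ^ (2 * k + 1)) x).
{ intros x; now apply continuous_Cpow. }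
exists (fun x => let t := circle r x in
  (t, t ^ (2 * k + 1) * sqrt1p (arg1 k alpha t) * sqrt1p (arg2 k alpha t))).
split; [split; [split | split] | ].
- intros x; apply continuous_prod; [apply hc | ].
  apply (continuous_Cmult (fun y => circle r y ^ (2 * k + 1) * sqrt1p (arg1 k alpha (circle r y)))
    (fun y => sqrt1p (arg2 k alpha (circle r y)))).
  + apply continuous_Cmult; [apply hpow | ].
    apply continuous_sqrt1p with q; [exact hq | exact h1 | ].
    unfold arg1, Cdiv; apply continuous_Cmult; [ | apply continuous_const].
    apply continuous_Cmult; [apply continuous_const | apply hpow].
  + apply continuous_sqrt1p with q; [exact hq | exact h2 | ].
    (* The inverse of [t] is the circle of radius [1 / r] run backwards, which reduces continuity to
       sums and products. *)
    apply (continuous_ext (fun y => RtoC (-1) * (circle r y *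
      (RtoC 8 + RtoC 2 * alpha * circle (/ r) (-1 * y) ^ (2 * k + 1)) ^ 2))).
    { intros y; unfold arg2, Cdiv.
      replace (-1 * y)%R with (- y)%R by ring.
      rewrite <- circle_inv, Cpow_inv by auto using circle_neq0.
      replace (RtoC (-1)) with (- RtoC 1) by (rewrite <- RtoC_opp; f_equal; lra).
      ring_C. }
    apply continuous_Cmult; [apply continuous_const | ].
    apply continuous_Cmult; [apply hc | apply continuous_Cpow].
    apply continuous_Cplus; [apply continuous_const | ].
    apply continuous_Cmult; [apply continuous_const | ].
    apply continuous_Cpow, continuous_circle.
- intros x; cbv zeta; now rewrite circle_period.
- intros x; cbv zeta; apply branch_on_curve; auto using circle_neq0, sqrt1p_sqr, sqrt1p_correct.
- intros x; reflexivity.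
- intros x; exists (sqrt1p (arg1 k alpha (circle r x))), (sqrt1p (arg2 k alpha (circle r x))).
  split; [ | split]; [now apply sqrt1p_correct | now apply sqrt1p_correct | reflexivity].
Qed.

(** A zero root would force [u = -1], outside the open unit disc. *)
Lemma sqrt1p_neq0 (u s : C) : (Cmod u < 1)%R -> is_sqrt1p u s -> s <> 0.
Proof.
intros hu hs e; assert (h := sqrt1p_sqr u s hu hs).
assert (hu1 : u = - RtoC 1) by (transitivity (s * s - RtoC 1); [rewrite h | rewrite e]; ring).
rewrite hu1, Cmod_m1 in hu; lra.
Qed.

(** On the circle [dt = i t dtheta], and [y = t ^ (2k+1) s1 s2], so the form becomes
    [i dtheta / (s1 s2)], to which [period_integral] applies. *)
Lemma is_gamma_period (k : nat) (rho : R -> R) (alpha : C) (q : R) (g : R -> C * C) :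
  alpha <> 0 -> (0 < rho (Cmod alpha))%R -> (0 <= q < 1)%R ->
  (forall x, (Cmod (arg1 k alpha (circle (rho (Cmod alpha)) x)) <= q)%R) ->
  (forall x, (Cmod (arg2 k alpha (circle (rho (Cmod alpha)) x)) <= q)%R) ->
  is_gamma k rho alpha g ->
  exists v : C, is_Ihat k alpha v /\ is_period k g v.
Proof.
intros ha hr hq h1 h2 [[_ [_ hcov]] hbr]; set (r := rho (Cmod alpha)) in *.
assert (hfst : forall x, fst (g x) = circle r x) by exact hcov.
assert (ht : forall x, circle r x <> 0) by (intros; now apply circle_neq0).
destruct (period_integral k alpha r q (fun x => snd (g x) / circle r x ^ (2 * k + 1))
  ha hr hq h1 h2) as [v [hv hI]].
{ intros x; destruct (hbr x) as [s1 [s2 [hs1 [hs2 e]]]]; rewrite hfst in hs1, hs2, e.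
  exists s1, s2; split; [exact hs1 | split; [exact hs2 | ]].
  rewrite e; field; now apply Cpow_nz. }
exists v; split; [exact hv | ].
(* The factor [2 PI i] is removed by the normalization in [is_period]. *)
exists (Ci * (RtoC (2 * PI) * v)); split.
- exists (fun x => Ci * circle r x); split.
  + intros x _; apply (is_derive_ext (V := C_R_NormedModule) (circle r)).
    * intros y; symmetry; apply hcov.
    * apply is_derive_circle.
  + apply (is_RInt_ext (V := C_R_NormedModule) (fun x => Ci * / (snd (g x) / circle r x ^ (2 * k + 1)))).
    * intros x _; destruct (hbr x) as [s1 [s2 [hs1 [hs2 e]]]]; rewrite hfst in hs1, hs2, e.
      assert (n1 : s1 <> 0).
      { apply (sqrt1p_neq0 (arg1 k alpha (circle r x))); [ | exact hs1].
        specialize (h1 x); lra. }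
      assert (n2 : s2 <> 0).
      { apply (sqrt1p_neq0 (arg2 k alpha (circle r x))); [ | exact hs2].
        specialize (h2 x); lra. }
      rewrite hfst, e, Nat.add_1_r, Cpow_S.
      assert (hp : circle r x ^ (2 * k) <> 0) by now apply Cpow_nz.
      assert (hx := ht x).
      match goal with |- ?a = ?b => change (@eq C a b) end;
        field; repeat split; assumption.
    * apply is_RInt_C_mult, hI.
- rewrite RtoC_mult; field.
  assert (hpi : RtoC PI <> 0) by (intros e; apply RtoC_inj in e; assert (h := PI_RGT_0); lra).
  assert (h2' : RtoC 2 <> 0) by (intros e; apply RtoC_inj in e; lra).
  assert (hi : Ci <> 0) by (intros e; injection e; intros e1; exact (R1_neq_R0 e1)).
  repeat split; assumption.
Qed.

Theorem theorem4 (k : nat) (hk : (0 < k)%nat)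
    (rho : R -> R) (hrho : admissible_radius k rho) :
  exists eps : R, (0 < eps)%R /\
    forall alpha : C, alpha <> RtoC 0 -> (Cmod alpha < eps)%R ->
      (exists gamma : R -> C * C, is_gamma k rho alpha gamma) /\
      (forall gamma : R -> C * C, is_gamma k rho alpha gamma ->
        exists v : C, is_Ihat k alpha v /\ is_period k gamma v).
Proof.
destruct (admissible_radius_small k rho hrho) as [eps [heps h]].
exists eps; split; [exact heps | intros alpha ha hsmall].
destruct (h (Cmod alpha)) as [hr [hb1 hb2]].
{ split; [now apply Cmod_gt_0 | exact hsmall]. }
(* On the circle [Cmod t] is the radius, so the bounds at [r = Cmod alpha] hold uniformly in the
   angle. *)
assert (h1 : forall x, (Cmod (arg1 k alpha (circle (rho (Cmod alpha)) x)) <= 1 / 2)%R).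
{ intros x; apply Cmod_arg1_le; [exact ha | now rewrite Cmod_circle]. }
assert (h2 : forall x, (Cmod (arg2 k alpha (circle (rho (Cmod alpha)) x)) <= 1 / 2)%R).
{ intros x; apply Cmod_arg2_le; [now apply circle_neq0 | now rewrite Cmod_circle]. }
split.
- apply (is_gamma_exists k rho alpha (1 / 2)); trivial; lra.
- intros g; apply (is_gamma_period k rho alpha (1 / 2)); trivial; lra.
Qed.
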